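(* Let $\mathcal{H}=\mathcal{V}\oplus\mathcal{W}^{\perp}$. Let $(\mathbf{W},\mathbf{w})$ be a fusion frame for $\mathcal{W}$, let $Q\in B(\mathcal{K}_{\mathbf{W}},\mathcal{K}_{\mathbf{V}})$ and let $(\mathbf{V},\mathbf{v})$ be an $\epsilon$-approximate oblique $Q$-dual fusion frame of $(\mathbf{W},\mathbf{w})$ on $\mathcal{V}$ with $0\le\epsilon<1$. For an integer $N\ge 0$ put $A_N=\sum_{n=0}^{N}\left(\pi_{\mathcal{V},\mathcal{W}^{\perp}}-T_{\mathbf{V},\mathbf{v}}QT_{\mathbf{W},\mathbf{w}}^{*}\right)^{n}\in B(\mathcal{H})$, where the term $n=0$ is the identity of $\mathcal{H}$. Let $\widetilde{\mathbf{v}}=\{\widetilde v_k\}_{k\in I}$ be a family of weights. If $(A_N\mathbf{V},\widetilde{\mathbf{v}})$ is a fusion Bessel sequence for $\mathcal{V}$ and $Q_{A_NT_{\mathbf{V},\mathbf{v}},\widetilde{\mathbf{v}}}$ is a well defined bounded operator, then $(A_N\mathbf{V},\widetilde{\mathbf{v}})$ is an $\epsilon^{N+1}$-approximate oblique $Q_{A_NT_{\mathbf{V},\mathbf{v}},\widetilde{\mathbf{v}}}Q$-dual fusion frame of $(\mathbf{W},\mathbf{w})$ on $\mathcal{V}$, and $$\left\|\pi_{\mathcal{V},\mathcal{W}^{\perp}}-T_{A_N\mathbf{V},\widetilde{\mathbf{v}}}\,Q_{A_NT_{\mathbf{V},\mathbf{v}},\widetilde{\mathbf{v}}}\,Q\,T_{\mathbf{W},\mathbf{w}}^{*}\right\|\le\epsilon^{N+1}\longrightarrow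 0\quad\text{as } N\to\infty .$$
   Context: $\mathcal{H}$ is a separable Hilbert space over $\mathbb{R}$ or $\mathbb{C}$, $\mathcal{V},\mathcal{W}$ are closed subspaces of $\mathcal{H}$, $I$ is a countable index set, and $B(\cdot,\cdot)$ denotes bounded linear operators. $\mathcal{H}=\mathcal{V}\oplus\mathcal{W}^{\perp}$ means a direct (not necessarily orthogonal) sum; $\pi_{\mathcal{V},\mathcal{W}^{\perp}}$ is the oblique projection with image $\mathcal{V}$ and kernel $\mathcal{W}^{\perp}$. Families of subspaces: $\mathbf{W}=\{W_i\}_{i\in I}$ is a family of closed subspaces of $\mathcal{W}$ and $\mathbf{w}=\{w_i\}_{i\in I}$ a family of weights, i.e. $w_i>0$ for all $i$ (all families of weights are assumed to be in $\ell^\infty(I)$); $(\mathbf{W},\mathbf{w})$ stands for $\{(W_i,w_i)\}_{i\in I}$. $\mathcal{K}_{\mathbf{W}}=\oplus_{i\in I}W_i$ is the Hilbert ($\ell^2$) direct sum. $(\mathbf{W},\mathbf{w})$ is a fusion frame for $\mathcal{W}$ if there are $0<\alpha\le\beta<\infty$ with $\alpha\|f\|^2\le\sum_{i\in I}w_i^2\|\pi_{W_i}f\|^2\le\beta\|f\|^2$ for all $f\in\mathcal{W}$ ($\pi_{W_i}$ the orthogonal projection onto $W_i$); it is a fusion Bessel sequence for $\mathcal{W}$ if only the upper inequality is required. In that case the synthesis operator $T_{\mathbf{W},\mathbf{w}}:\mathcal{K}_{\mathbf{W}}\to\mathcal{H}$, $(f_i)_{i}\mapsto\sum_i w_if_i$,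 is bounded, with adjoint $T_{\mathbf{W},\mathbf{w}}^{*}f=(w_i\pi_{W_i}f)_{i}$. The same notation is used for $(\mathbf{V},\mathbf{v})$ with closed subspaces $V_i$ of $\mathcal{V}$. For an operator $A$, $A\mathbf{V}=\{AV_i\}_{i\in I}$. For $\epsilon\ge0$ and $Q\in B(\mathcal{K}_{\mathbf{W}},\mathcal{K}_{\mathbf{V}})$, a fusion frame $(\mathbf{V},\mathbf{v})$ for $\mathcal{V}$ is an $\epsilon$-approximate oblique $Q$-dual fusion frame of the fusion frame $(\mathbf{W},\mathbf{w})$ for $\mathcal{W}$ on $\mathcal{V}$ if $\|T_{\mathbf{V},\mathbf{v}}QT_{\mathbf{W},\mathbf{w}}^{*}-\pi_{\mathcal{V},\mathcal{W}^{\perp}}\|\le\epsilon$. For $j\in I$, $M_j$ denotes the operator on a space $\mathcal{K}_{\mathbf{U}}$ which keeps the $j$-th component and replaces all the others by $0$. For a bounded operator $L:\mathcal{K}_{\mathbf{U}}\to\mathcal{V}$ and weights $\mathbf{u}=\{u_i\}$, $Q_{L,\mathbf{u}}$ is the map defined on $\mathcal{K}_{\mathbf{U}}$ by $Q_{L,\mathbf{u}}(f_j)_{j\in I}=\left(\frac{1}{u_i}LM_i(f_j)_{j\in I}\right)_{i\in I}$, with values in $\oplus_{i\in I}LM_i\mathcal{K}_{\mathbf{U}}$. In particular $Q_{A_NT_{\mathbf{V},\mathbf{v}},\widetilde{\mathbf{v}}}:\mathcal{K}_{\mathbf{V}}\to\mathcal{K}_{A_N\mathbf{V}}$, $(f_i)_i\mapsto\left(\frac{v_i}{\widetilde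 v_i}A_Nf_i\right)_i$. *)

(* Defs.v *)
From HB Require Import structures.
From mathcomp Require Import all_boot all_order all_algebra.
From mathcomp Require Import complex.
From mathcomp Require Import sesquilinear finmap.
From mathcomp Require Import all_classical all_reals all_analysis.
From mathcomp.analysis.showcase Require summability.

Set Implicit Arguments.
Unset Strict Implicit.
Unset Printing Implicit Defensive.
Import Order.TTheory GRing.Theory Num.Theory.
Import numFieldNormedType.Exports.
Local Open Scope classical_set_scope.
Local Open Scope ring_scope.

Variant scalar_kind := RealScalars | ComplexScalars.

Definition scalars (R : realType) (k : scalar_kind) : numFieldType :=
  match k with RealScalars => R | ComplexScalars => R[i] end.

Definition sconj (R : realType) (k : scalar_kind) :
    {rmorphism scalars R k -> scalars R k} :=
  match k return {rmorphism scalars R k -> scalars R k} with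
  | RealScalars => idfun
  | ComplexScalars => @conjc R
  end.

Definition sre (R : realType) (k : scalar_kind) : scalars R k -> R :=
  match k return scalars R k -> R with
  | RealScalars => id
  | ComplexScalars => @complex.Re R
  end.

Definition sinj (R : realType) (k : scalar_kind) : R -> scalars R k :=
  match k return R -> scalars R k with
  | RealScalars => id
  | ComplexScalars => real_complex R
  end.

(* The inner product is linear in its first argument. *)
Record hilbertSpace (R : realType) (k : scalar_kind) := HilbertSpace {
  hsort :> completeNormedModType (scalars R k);
  dot : {dot hsort for @sconj R k};
  dotE : forall x, dot x x = `|x| ^+ 2 }.

Definition separable (T : topologicalType) : Prop :=
  exists2 D : set T, countable D & dense D.

Section Hilbert.
Context {R : realType} {k : scalar_kind} {H : hilbertSpace R k}.
Local Notation K := (scalars R k).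
Implicit Types (U V W : set H).

(* In the library the norm of a normed module over a complex field is itself
   complex-valued (with real nonnegative values). *)
Definition hnorm (x : H) : R := sre `|x|.

(* The supremum is extended-real-valued, so unbounded operators get +oo. *)
Definition opnorm (A : H -> H) : \bar R :=
  ereal_sup [set (hnorm (A x))%:E | x in [set x | hnorm x <= 1]].

Definition closed_subspace U : Prop :=
  [/\ U 0, forall (a : K) x y, U x -> U y -> U (a *: x + y) & closed U].

Definition orth U : set H := [set x | forall y, U y -> dot H x y = 0].

Definition direct_sum U V : Prop :=
  (forall x, U x -> V x -> x = 0) /\
  (forall x, exists u v, [/\ U u, V v & x = u + v]).

(* When H is the direct sum of U and V, this is the projection with image U
   and kernel V. *)
Definition oblique_proj U V (x : H) : H := xget 0 [set u | U u /\ V (x - u)].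

Definition orth_proj U : H -> H := oblique_proj U (orth U).

Section Families.
Context {I : countType}.
Implicit Types (Wf Vf : I -> set H) (w v : I -> R) (f g : I -> H).

(* The square of the l^2 norm. *)
Definition l2sq f : \bar R := \esum_(i in [set: I]) ((hnorm (f i)) ^+ 2)%:E.

Definition l2norm f : R := Num.sqrt (fine (l2sq f)).

(* The sum of the inner products over I is unordered (limit along the finite
   subsets of I). *)
Definition l2dot f g : K :=
  summability.sum (fun i => dot H (f i) (g i) : K^o).

Definition hilbert_sum Wf : set (I -> H) :=
  [set f | (forall i, Wf i (f i)) /\ (l2sq f < +oo)%E].

(* Bounded linear operators between Hilbert sums are represented by maps on all
   families, whose values outside of the source Hilbert sum are irrelevant. *)
Definition bounded_operator (D E : set (I -> H)) (Q : (I -> H) -> I -> H) :=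
  [/\ forall f, D f -> E (Q f),
      forall (a : K) f g, D f -> D g -> Q (a *: f + g) = a *: Q f + Q g
    & exists C : R, forall f, D f -> l2norm (Q f) <= C * l2norm f].

(* The Hilbert space adjoint of an operator T defined on the Hilbert sum D. *)
Definition adjoint (D : set (I -> H)) (T : (I -> H) -> H) (x : H) : I -> H :=
  xget 0 [set h | D h /\ forall g, D g -> dot H (T g) x = l2dot g h].

Definition weights w : Prop :=
  (forall i, 0 < w i) /\ exists C : R, forall i, w i <= C.

Definition subspace_family W Wf : Prop :=
  forall i, closed_subspace (Wf i) /\ Wf i `<=` W.

Definition frame_sum Wf w (x : H) : \bar R :=
  \esum_(i in [set: I]) ((w i) ^+ 2 * (hnorm (orth_proj (Wf i) x)) ^+ 2)%:E.

Definition fusion_bessel W Wf w : Prop :=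
  [/\ subspace_family W Wf, weights w &
    exists2 beta : R, 0 < beta & forall x, W x ->
      (frame_sum Wf w x <= (beta * (hnorm x) ^+ 2)%:E)%E].

Definition fusion_frame W Wf w : Prop :=
  [/\ subspace_family W Wf, weights w &
    exists alpha beta : R, [/\ 0 < alpha, alpha <= beta & forall x, W x ->
      ((alpha * (hnorm x) ^+ 2)%:E <= frame_sum Wf w x)%E /\
      (frame_sum Wf w x <= (beta * (hnorm x) ^+ 2)%:E)%E]].

(* Unordered sum; meaningful on the Hilbert sum of the family. *)
Definition synthesis w f : H := summability.sum (fun i => sinj k (w i) *: f i).

Definition analysis Wf w : H -> I -> H :=
  adjoint (hilbert_sum Wf) (synthesis w).

Definition dual_operator Wf w v (Q : (I -> H) -> I -> H) (x : H) : H :=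
  synthesis v (Q (analysis Wf w x)).

Definition approx_oblique_dual V W (eps : R) (Q : (I -> H) -> I -> H)
    Wf w Vf v : Prop :=
  [/\ 0 <= eps, fusion_frame W Wf w, fusion_frame V Vf v,
      bounded_operator (hilbert_sum Wf) (hilbert_sum Vf) Q
    & (opnorm (fun x => (dual_operator Wf w v Q x
                         - oblique_proj V (orth W) x)%R) <= eps%:E)%E].

Definition component (j : I) f : I -> H := fun i => if i == j then f j else 0.

Definition Qmap (L : (I -> H) -> H) (u : I -> R) f : I -> H :=
  fun i => sinj k (u i)^-1 *: L (component i f).

Definition image_family (A : H -> H) Vf : I -> set H := fun i => A @` Vf i.

End Families.

Definition geometric_sum (E : H -> H) (N : nat) (x : H) : H :=
  \sum_(0 <= n < N.+1) iter n E x.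

End Hilbert.

(* Main.v *)
Require Import Defs.
From mathcomp Require Import all_boot all_order all_algebra.
From mathcomp Require Import all_classical all_reals all_analysis.
From mathcomp Require Import complex sesquilinear finmap ring lra.
From mathcomp.analysis.showcase Require summability.
Import Order.TTheory GRing.Theory Num.Theory.
Import numFieldNormedType.Exports.
Local Open Scope classical_set_scope.
Local Open Scope ring_scope.

(** Write [P] for the oblique projection, [D = T_V Q T_W^*] and [E = P - D], so
that [A_N] is the truncated Neumann series [1 + E + ... + E^N].

The operator [T_W^*] vanishes on the orthogonal complement of [W], which is
the kernel of [P]; hence [D P = D] and, as [P] is idempotent, [E P = E]. With
[D = P - E] the product [A_N D] telescopes to [P - E^(N+1)]
([geometric_sum_defect]). On the other side the weights in the definition of
the map [Q_(A_N T_V, vt)] cancel those of the new synthesis operator, so that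
composing the two yields [A_N T_V] ([synthesis_Qmap]). Therefore the defect of
the new dual is exactly [E^(N+1)], whose norm is at most [eps^(N+1)].

It remains to see that the new Bessel sequence is a frame for [V]. This holds
for any approximate dual whose defect is less than [1] on [V]
([approximate_dual_fusion_frame]): for [x] in [V] the inner product [<D' x, x>]
is at least [(1 - e) |x|^2], while [D' x] is synthesized from a family of norm
at most a constant times [|x|], so that [<D' x, x>] is also bounded by that
constant times [|x|] and the square root of the frame sum of [x].

These arguments rest on the explicit form of the adjoint,
[T_W^* x = (w_i pi_i x)_i] ([analysisE]), on the convergence of the sums that
define the synthesis operator ([synthesis_cvg]), and on the projection theorem
([direct_sum_orth]). Real and complex scalars are treated together: the real
part of the inner product is a real inner product with the same norm, and
multiplying by phases recovers the full inner product from it. *)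

Set Implicit Arguments.
Unset Strict Implicit.
Unset Printing Implicit Defensive.

#[local] Existing Instance summability.totally_filter.

(** * Scalars *)

Section Scalars.
Context {R : realType} {k : scalar_kind}.
Local Notation K := (scalars R k).
Implicit Types (z : K) (r s : R).

Lemma sreD z1 z2 : sre (z1 + z2) = sre z1 + sre z2.
Proof. by case: k z1 z2 => //= -[a b] [c d]. Qed.

Lemma sre0 : sre (0 : K) = 0.
Proof. by case: k. Qed.

Lemma sreZ r z : sre (sinj k r * z) = r * sre z.
Proof. by case: k z => //= -[a b] /=; rewrite mul0r subr0. Qed.

Lemma sinjK r : sre (sinj k r) = r.
Proof. by case: k. Qed.

Lemma sinjD r s : sinj k (r + s) = sinj k r + sinj k s.
Proof. by case: k => //=; rewrite rmorphD. Qed.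

Lemma sinjM r s : sinj k (r * s) = sinj k r * sinj k s.
Proof. by case: k => //=; rewrite rmorphM. Qed.

Lemma sinj0 : sinj k 0 = 0 :> K.
Proof. by case: k. Qed.

Lemma sinj1 : sinj k 1 = 1 :> K.
Proof. by case: k. Qed.

Lemma sinj_le r s : (sinj k r <= sinj k s) = (r <= s).
Proof. by case: k => //=; rewrite lecR. Qed.

Lemma sinj_lt r s : (sinj k r < sinj k s) = (r < s).
Proof. by case: k => //=; rewrite ltcR. Qed.

Lemma sre_ge0K z : 0 <= z -> sinj k (sre z) = z.
Proof.
case: k z => //= -[a b]; rewrite lecE /= => /andP[/eqP b0 _].
by rewrite /real_complex_def -b0.
Qed.

Lemma sre_conj z : sre (sconj R k z) = sre z.
Proof. by case: k z => //= -[a b]. Qed.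

Lemma sconjK z : sconj R k (sconj R k z) = z.
Proof. by case: k z => //= -[a b] /=; rewrite opprK. Qed.

Lemma sconj_inj r : sconj R k (sinj k r) = sinj k r.
Proof. by case: k => //=; rewrite oppr0. Qed.

(** Transfers bounds on real parts to moduli. *)
Lemma unit_phase z : exists2 a : K, `|a| = 1 & a * z = `|z|.
Proof.
have [->|z0] := eqVneq z 0; first by exists 1; rewrite ?normr1 // mulr0 normr0.
exists (`|z| / z); last by rewrite divfK.
by rewrite normrM normfV normr_id divff // normr_eq0.
Qed.

End Scalars.

(** * The real part of the inner product *)

Section InnerProduct.
Context {R : realType} {k : scalar_kind} {H : hilbertSpace R k}.
Local Notation K := (scalars R k).
Implicit Types (x y z : H) (a : K) (r : R).

Definition rdot x y : R := sre (dot H x y).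

Lemma dotDl x y z : dot H (x + y) z = dot H x z + dot H y z.
Proof. by rewrite linearDl. Qed.

Lemma dotDr x y z : dot H z (x + y) = dot H z x + dot H z y.
Proof. by rewrite linearDr. Qed.

Lemma dotZl a x y : dot H (a *: x) y = a * dot H x y.
Proof. by rewrite linearZl_LR. Qed.

Lemma dotZr a x y : dot H x (a *: y) = sconj R k a * dot H x y.
Proof. by rewrite linearZr_LR. Qed.

Lemma dotC x y : dot H x y = sconj R k (dot H y x).
Proof. by rewrite (hermC (dot H)) /= expr0 mul1r. Qed.

Lemma dot0l y : dot H 0 y = 0.
Proof. by rewrite linear0l. Qed.

Lemma hnormK x : sinj k (hnorm x) = `|x|.
Proof. by rewrite sre_ge0K. Qed.

Lemma hnorm_ge0 x : 0 <= hnorm x.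
Proof. by rewrite -(@sinj_le R k) hnormK sinj0. Qed.

Lemma hnorm0 : hnorm (0 : H) = 0.
Proof. by rewrite /hnorm normr0 sre0. Qed.

Lemma hnorm_eq0 x : hnorm x = 0 -> x = 0.
Proof. by move=> x0; apply/normr0_eq0; rewrite -hnormK x0 sinj0. Qed.

Lemma hnorm_triangle x y : hnorm (x + y) <= hnorm x + hnorm y.
Proof. by rewrite -(@sinj_le R k) sinjD !hnormK ler_normD. Qed.

Lemma hnorm_opp x : hnorm (- x) = hnorm x.
Proof. by rewrite /hnorm normrN. Qed.

Lemma hdistC x y : hnorm (x - y) = hnorm (y - x).
Proof. by rewrite -hnorm_opp opprB. Qed.

Lemma hnormZ a x : hnorm (a *: x) = sre `|a| * hnorm x.
Proof. by rewrite /hnorm normrZ -(sre_ge0K (normr_ge0 a)) sreZ sinjK. Qed.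

Lemma hnormZr r x : 0 <= r -> hnorm (sinj k r *: x) = r * hnorm x.
Proof.
by move=> r0; rewrite hnormZ ger0_norm ?sinjK // -(@sinj0 R k) sinj_le.
Qed.

Lemma rdotDl x y z : rdot (x + y) z = rdot x z + rdot y z.
Proof. by rewrite /rdot dotDl sreD. Qed.

Lemma rdotDr x y z : rdot z (x + y) = rdot z x + rdot z y.
Proof. by rewrite /rdot dotDr sreD. Qed.

Lemma rdotC x y : rdot x y = rdot y x.
Proof. by rewrite /rdot dotC sre_conj. Qed.

Lemma rdotZl r x y : rdot (sinj k r *: x) y = r * rdot x y.
Proof. by rewrite /rdot dotZl sreZ. Qed.

Lemma rdotZr r x y : rdot x (sinj k r *: y) = r * rdot x y.
Proof. by rewrite rdotC rdotZl rdotC. Qed.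

Lemma rdot0l x : rdot 0 x = 0. Proof. by rewrite /rdot dot0l sre0. Qed.

Lemma rdotNl x y : rdot (- x) y = - rdot x y.
Proof. by apply/eqP; rewrite -addr_eq0 -rdotDl addNr rdot0l. Qed.

Lemma rdotNr x y : rdot x (- y) = - rdot x y.
Proof. by rewrite rdotC rdotNl rdotC. Qed.

Lemma rdotxx x : rdot x x = hnorm x ^+ 2.
Proof. by rewrite /rdot dotE -hnormK expr2 sreZ sinjK. Qed.

Lemma hnorm_sqrD x y :
  hnorm (x + y) ^+ 2 = hnorm x ^+ 2 + 2 * rdot x y + hnorm y ^+ 2.
Proof. by rewrite -!rdotxx rdotDl !rdotDr (rdotC y x); ring. Qed.

Lemma hnorm_sqrB x y :
  hnorm (x - y) ^+ 2 = hnorm x ^+ 2 - 2 * rdot x y + hnorm y ^+ 2.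
Proof. by rewrite hnorm_sqrD rdotNr hnorm_opp; ring. Qed.

(** The norm is subadditive by hypothesis, so the Cauchy-Schwarz inequality
comes from expanding the square of the triangle inequality. *)
Lemma rdot_le x y : rdot x y <= hnorm x * hnorm y.
Proof.
have : hnorm (x + y) ^+ 2 <= (hnorm x + hnorm y) ^+ 2.
  by rewrite ler_pXn2r ?nnegrE ?addr_ge0 ?hnorm_ge0 // hnorm_triangle.
by rewrite hnorm_sqrD; lra.
Qed.

(** A phase turning the inner product into its modulus reduces the
Cauchy-Schwarz inequality to its real part. *)
Lemma dot_le x y : `|dot H x y| <= `|x| * `|y|.
Proof.
have [a a1 ea] := unit_phase (dot H x y).
rewrite -(sre_ge0K (normr_ge0 (dot H x y))) -!hnormK -sinjM sinj_le -ea -dotZl.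
apply: le_trans (rdot_le _ _) _.
by rewrite hnormZ a1 -(@sinj1 R k) sinjK mul1r.
Qed.

(** Rotating [y] by a phase makes the real part see the whole modulus. *)
Lemma rdot_eq0_dot x (U : set H) : (forall a y, U y -> U (a *: y)) ->
  (forall y, U y -> rdot x y = 0) -> orth U x.
Proof.
move=> UZ x0 y Uy; have [a _ ea] := unit_phase (dot H x y).
have := x0 _ (UZ (sconj R k a) y Uy).
rewrite /rdot dotZr sconjK ea => e.
by apply/normr0_eq0; rewrite -(sre_ge0K (normr_ge0 (dot H x y))) e sinj0.
Qed.

Lemma cvg_hnormP {T} {F : set_system T} {FF : Filter F} (f : T -> H) l :
  f @ F --> l <-> forall e : R, 0 < e -> \forall t \near F, hnorm (l - f t) < e.
Proof.
split=> [/cvgrPdist_lt fl e e0|fl].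
  have := fl (sinj k e); rewrite -(@sinj0 R k) sinj_lt => /(_ e0).
  by apply: filterS => t; rewrite -hnormK sinj_lt.
apply/cvgrPdist_lt => e e0; have ee := sre_ge0K (ltW e0).
have := fl (sre e); rewrite -(@sinj_lt R k) ee sinj0 => /(_ e0).
by apply: filterS => t; rewrite -(@sinj_lt R k) hnormK ee.
Qed.

Lemma hnorm_cauchy_cvg {T} {F : set_system T} {FF : ProperFilter F}
    (f : T -> H) :
  (forall e : R, 0 < e ->
    exists x : H, \forall t \near F, hnorm (x - f t) < e) ->
  exists l : H, f @ F --> l.
Proof.
move=> fF; suff fc : @cauchy H (f @ F).
  by apply/cvg_ex; apply: (@cauchy_cvg H).
apply: cauchy_exP => e e0.
have ee := sre_ge0K (ltW e0).
have := fF (sre e); rewrite -(@sinj_lt R k) ee sinj0 => /(_ e0) [x xF].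
exists x; rewrite /= nbhs_simpl; near=> t.
rewrite -ball_normE /ball_ /= -hnormK -ee sinj_lt; near: t; exact: xF.
Unshelve. all: by end_near. Qed.

Lemma cvg_rdot_le {T} {F : set_system T} {FF : ProperFilter F}
    (f : T -> H) l y (M : R) :
  f @ F --> l -> (forall t, rdot (f t) y <= M) -> rdot l y <= M.
Proof.
move=> /cvg_hnormP fl fM; apply/ler_addgt0Pr => e e0.
have [t lt] : exists t, hnorm (l - f t) < e / (hnorm y + 1).
  by apply: (filter_ex (fl _ _)); rewrite divr_gt0 // ltr_wpDl ?hnorm_ge0.
rewrite -(subrK (f t) l) rdotDl addrC lerD //.
apply: le_trans (rdot_le _ _) _.
have y0 := hnorm_ge0 y; rewrite ltr_pdivlMr in lt; last by lra.
have := hnorm_ge0 (l - f t); nra.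
Qed.

Lemma cvg_dot {T} {F : set_system T} {FF : ProperFilter F} (f : T -> H) l y :
  f @ F --> l -> (fun t => dot H (f t) y : K^o) @ F --> (dot H l y : K^o).
Proof.
move=> /cvgrPdist_lt fl; apply/cvgrPdist_lt => e e0.
have y1 : 0 < `|y| + 1 by rewrite ltr_wpDl.
have := fl (e / (`|y| + 1)); rewrite divr_gt0 // => /(_ isT).
apply: filterS => t; rewrite ltr_pdivlMr // => lt.
rewrite -scaleN1r -[_ *: dot H _ _]/(-1 * dot H (f t) y) -dotZl -dotDl scaleN1r.
apply: le_lt_trans (dot_le _ _) _; apply: le_lt_trans lt.
by rewrite ler_wpM2l // lerDl.
Qed.

End InnerProduct.

(** * Oblique and orthogonal projections *)

Section Projections.
Context {R : realType} {k : scalar_kind} {H : hilbertSpace R k}.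
Local Notation K := (scalars R k).
Implicit Types (x y z : H) (a : K) (r : R) (U V : set H).

Definition subspace U : Prop :=
  U 0 /\ forall a x y, U x -> U y -> U (a *: x + y).

Lemma closed_subspaceW U : closed_subspace U -> subspace U.
Proof. by case. Qed.

Section Subspace.
Variables (U : set H) (sU : subspace U).

Lemma subspace0 : U 0. Proof. exact: sU.1. Qed.

Lemma subspaceZ a x : U x -> U (a *: x).
Proof. by move=> Ux; rewrite -[_ *: _]addr0; apply: sU.2 => //; case: sU. Qed.

Lemma subspaceD x y : U x -> U y -> U (x + y).
Proof. by move=> Ux Uy; rewrite -[x]scale1r; exact: sU.2. Qed.

Lemma subspaceB x y : U x -> U y -> U (x - y).
Proof. by move=> Ux Uy; rewrite addrC -scaleN1r; exact: sU.2. Qed.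

Lemma subspace_sum (J : Type) (s : seq J) (F : J -> H) :
  (forall j, U (F j)) -> U (\sum_(j <- s) F j).
Proof.
by move=> FU; apply: big_ind => //; [exact: subspace0|exact: subspaceD].
Qed.

End Subspace.

Lemma subspace_orth U : subspace (orth U).
Proof.
split=> [y _|a x y xU yU z Uz]; first by rewrite dot0l.
by rewrite dotDl dotZl xU // yU // mulr0 addr0.
Qed.

Lemma orth_dot U x y : orth U x -> U y -> dot H y x = 0.
Proof. by move=> xU Uy; rewrite dotC xU // rmorph0. Qed.

Lemma orthS U V : U `<=` V -> orth V `<=` orth U.
Proof. by move=> UV x xV y /UV/xV. Qed.

Section Oblique.
Variables (U V : set H) (sU : subspace U) (sV : subspace V).
Hypothesis UV : direct_sum U V.

Lemma oblique_projP x : U (oblique_proj U V x) /\ V (x - oblique_proj U V x).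
Proof.
rewrite /oblique_proj; case: xgetP => [y _ //|/= no].
have [u [v [Uu Vv e]]] := UV.2 x.
by case: (no u); split=> //; rewrite e addrC addKr.
Qed.

Lemma oblique_proj_eq x u : U u -> V (x - u) -> oblique_proj U V x = u.
Proof.
move=> Uu Vu; have [UP VP] := oblique_projP x.
apply/eqP; rewrite -subr_eq0; apply/eqP; apply: UV.1; first exact: subspaceB.
rewrite (_ : _ - u = (x - u) - (x - oblique_proj U V x)).
  exact: subspaceB.
by rewrite opprB [RHS]addrC addrA subrK.
Qed.

Lemma oblique_proj_id u : U u -> oblique_proj U V u = u.
Proof.
by move=> Uu; apply: oblique_proj_eq => //; rewrite subrr; exact: sV.1.
Qed.

Lemma oblique_proj_linear a x y :
  oblique_proj U V (a *: x + y) = a *: oblique_proj U V x + oblique_proj U V y.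
Proof.
have [Ux Vx] := oblique_projP x; have [Uy Vy] := oblique_projP y.
apply: oblique_proj_eq; first exact: sU.2.
by rewrite opprD addrACA -scalerBr; exact: sV.2.
Qed.

End Oblique.

Lemma quadratic_ge0_eq0 (b c : R) :
  0 <= c -> (forall t, 0 <= t ^+ 2 * c - 2 * t * b) -> b = 0.
Proof.
move=> c0 h; apply/eqP; rewrite -sqrf_eq0 eq_le sqr_ge0 andbT.
have c1 : 0 < c + 1 by lra.
(* The minimizer [b / c], shifted so that [c = 0] is covered as well. *)
have := h (b / (c + 1)).
rewrite (_ : _ - _ = - (b ^+ 2 * ((c + 2) / (c + 1) ^+ 2))); last first.
  by field; rewrite gt_eqF.
by rewrite oppr_ge0 pmulr_lle0 // divr_gt0 ?exprn_gt0 //; lra.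
Qed.

(** A point of [U] nearest to [x] is the foot of the perpendicular from [x]:
moving it along any [y] in [U] cannot decrease the distance. *)
Lemma nearest_orth U x u : subspace U -> U u ->
  (forall u', U u' -> hnorm (x - u) <= hnorm (x - u')) -> orth U (x - u).
Proof.
move=> sU Uu umin; apply: rdot_eq0_dot => [a y|y Uy]; first exact: subspaceZ.
apply: (@quadratic_ge0_eq0 _ (hnorm y ^+ 2)) => [|t]; first exact: sqr_ge0.
have := umin (sinj k t *: y + u) (sU.2 _ _ _ Uy Uu).
rewrite (_ : x - (_ + u) = (x - u) - sinj k t *: y); last first.
  by rewrite opprD addrA addrAC.
rewrite -(@ler_pXn2r _ 2) ?nnegrE ?hnorm_ge0 // (hnorm_sqrB (x - u)) rdotZr.
rewrite -(rdotxx (sinj k t *: y)) rdotZl rdotZr rdotxx; nra.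
Qed.

Lemma parallelogram x u v :
  hnorm (u - v) ^+ 2 = 2 * hnorm (x - u) ^+ 2 + 2 * hnorm (x - v) ^+ 2
    - 4 * hnorm (x - sinj k 2^-1 *: (u + v)) ^+ 2.
Proof.
rewrite -!rdotxx !(rdotDl, rdotDr, rdotNl, rdotNr, rdotZl, rdotZr).
rewrite (rdotC v u) (rdotC u x) (rdotC v x).
by field.
Qed.

(** The projection theorem. The sets of points of [U] whose distance to [x] is
within [e] of the infimum generate a filter; by the parallelogram identity it
is Cauchy, and its limit is a nearest point of [U]. *)
Theorem direct_sum_orth U : closed_subspace U -> direct_sum U (orth U).
Proof.
move=> cU; have sU := closed_subspaceW cU; have [_ _ clU] := cU.
split=> [x Ux xU|x].
  by apply: hnorm_eq0; apply/eqP; rewrite -sqrf_eq0 -rdotxx /rdot xU // sre0.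
pose S := [set hnorm (x - u) | u in U]; pose d := inf S.
have S_inf : has_inf S.
  split; first by exists (hnorm (x - 0)); exists 0 => //; exact: subspace0.
  by exists 0 => _ [u _ <-]; exact: hnorm_ge0.
have dle u : U u -> d <= hnorm (x - u).
  by move=> Uu; apply: ge_inf; [exact: S_inf.2|exists u].
have d0 : 0 <= d.
  by apply: lb_le_inf; [exact: S_inf.1|move=> _ [u _ <-]; exact: hnorm_ge0].
pose G (e : R) := [set u | U u /\ hnorm (x - u) < d + e].
pose F := filter_from [set e : R | 0 < e] G.
have GF : ProperFilter F.
  apply: filter_from_proper => [|e /= e0]; last first.
    by have [_ [u Uu <-] ue] := inf_adherent e0 S_inf; exists u.
  apply: filter_from_filter => [|e f /= e0 f0]; first by exists 1 => /=.
  exists (Num.min e f); first by rewrite lt_min e0.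
  move=> u [Uu]; rewrite -ltrBlDl lt_min => /andP[ue uf].
  by split; split=> //; rewrite -ltrBlDl.
have G_near u v (e : R) : 0 < e <= 1 -> G e u -> G e v ->
    hnorm (u - v) ^+ 2 <= 4 * e * (2 * d + 1).
  move=> /andP[e0 e1] [Uu ue] [Uv ve].
  have := dle (sinj k 2^-1 *: (u + v)) (subspaceZ sU _ (subspaceD sU Uu Uv)).
  rewrite (parallelogram x).
  have := hnorm_ge0 (x - u); have := hnorm_ge0 (x - v).
  nra.
have [u Fu] : exists u : H, F --> u.
  apply: (@hnorm_cauchy_cvg R k H H F GF id) => e e0.
  (* [4 e' (2 d + 1) < e^2] is what [G_near] requires. *)
  pose e' := Num.min 1 (e ^+ 2 / (4 * (2 * d + 2))).
  have d2 : 0 < 4 * (2 * d + 2) by lra.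
  have e'0 : 0 < e' by rewrite lt_min ltr01 divr_gt0 ?exprn_gt0.
  have e'1 : e' <= 1 by rewrite ge_min lexx.
  have [u0 Gu0] : G e' !=set0 by apply: (@filter_ex _ F GF); exists e'.
  exists u0; exists e' => // u Gu /=.
  rewrite -(@ltr_pXn2r _ 2) ?nnegrE ?hnorm_ge0 ?ltW //.
  apply: le_lt_trans (G_near _ _ e' _ Gu0 Gu) _; first by rewrite e'0.
  have : e' <= e ^+ 2 / (4 * (2 * d + 2)) by rewrite ge_min lexx orbT.
  by rewrite ler_pdivlMr //; nra.
have Uu : U u.
  apply: (@closed_cvg _ _ F _ id U clU _ u Fu).
  by exists 1 => //= v [].
exists u, (x - u); split=> //; last by rewrite addrC subrK.
apply: nearest_orth => // u' Uu'; apply: le_trans (dle u' Uu').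
apply/ler_addgt0Pr => e e0.
have e20 : 0 < e / 2 by rewrite divr_gt0.
have uF : F [set v | hnorm (u - v) < e / 2].
  exact: (@cvg_hnormP R k H H F _ id u).1 Fu _ e20.
have [v [/= uv [_ xv]]] : exists v, hnorm (u - v) < e / 2 /\ G (e / 2) v.
  by apply: (@filter_ex _ F GF); apply: filterI; [exact: uF|exists (e / 2)].
rewrite -(subrK v x) -addrA.
have := hnorm_triangle (x - v) (v - u); rewrite (hdistC v u); lra.
Qed.

Section OrthProj.
Variables (U : set H) (cU : closed_subspace U).
Let sU := closed_subspaceW cU.

Lemma orth_projP x : U (orth_proj U x) /\ orth U (x - orth_proj U x).
Proof. exact: oblique_projP (direct_sum_orth cU) x. Qed.

Lemma orth_proj_eq x u : U u -> orth U (x - u) -> orth_proj U x = u.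
Proof.
apply: (oblique_proj_eq sU _ (direct_sum_orth cU)); exact: subspace_orth.
Qed.

Lemma orth_proj_linear a x y :
  orth_proj U (a *: x + y) = a *: orth_proj U x + orth_proj U y.
Proof.
apply: (oblique_proj_linear sU _ (direct_sum_orth cU)); exact: subspace_orth.
Qed.

Lemma orth_proj0 x : orth U x -> orth_proj U x = 0.
Proof. by move=> xU; apply: orth_proj_eq; [exact: sU.1|rewrite subr0]. Qed.

Lemma dot_orth_proj x y : U y -> dot H y (orth_proj U x) = dot H y x.
Proof.
move=> Uy; have [_ xU] := orth_projP x.
by rewrite -[in RHS](subrK (orth_proj U x) x) dotDr (orth_dot xU Uy) add0r.
Qed.

Lemma rdot_orth_proj x y : U y -> rdot y (orth_proj U x) = rdot y x.
Proof. by move=> Uy; rewrite /rdot dot_orth_proj. Qed.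

Lemma hnorm_orth_proj x : hnorm (orth_proj U x) <= hnorm x.
Proof.
have [Up _] := orth_projP x; have := rdot_le (orth_proj U x) x.
rewrite -rdot_orth_proj // rdotxx.
by have := hnorm_ge0 (orth_proj U x); have := hnorm_ge0 x; nra.
Qed.

Lemma orth_proj_sub V x : closed_subspace V -> U `<=` V ->
  orth_proj U (orth_proj V x) = orth_proj U x.
Proof.
move=> cV UV; have [Up xU] := orth_projP (orth_proj V x).
have xV := (oblique_projP (direct_sum_orth cV) x).2.
apply/esym/orth_proj_eq => //.
rewrite -{1}(subrK (orth_proj V x) x) -addrA.
by apply: (subspaceD (subspace_orth U)) => //; exact: orthS UV _ xV.
Qed.

End OrthProj.

End Projections.

(** * Unordered sums *)

Section UnorderedSums.
Context {I : choiceType}.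
Implicit Types (J : {fset I}).

Lemma big_fset_sub (M : zmodType) (F : I -> M) J0 J : (J0 `<=` J)%fset ->
  \sum_(i <- J) F i = \sum_(i <- J0) F i + \sum_(i <- (J `\` J0)%fset) F i.
Proof.
move=> J0J; rewrite (big_fsetID _ (mem J0)) /=; congr (_ + _).
  by apply: eq_fbigl => i; rewrite !inE /= andb_idl // => /(fsubsetP J0J).
by apply: eq_fbigl => i; rewrite !inE /= andbC.
Qed.

Lemma totally_fsuper J0 : \forall J \near summability.totally, (J0 `<=` J)%fset.
Proof. by exists J0. Qed.

Lemma sum_cvg (K : numFieldType) (E : normedModType K) (x : I -> E) (l : E) :
  (fun J => \sum_(i <- J) x i) @ summability.totally --> l ->
  summability.sum x = l.
Proof.
move=> xl; rewrite /summability.sum.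
rewrite (_ : summability.partial_sum x = fun J => \sum_(i <- J) x i).
  by apply: cvg_lim => //; exact: norm_hausdorff.
by apply/funext => J; rewrite big_seq_fsetE.
Qed.

Lemma sum_single (K : numFieldType) (E : normedModType K) (x : I -> E) i :
  (forall j, j != i -> x j = 0) -> summability.sum x = x i.
Proof.
move=> x0; apply: sum_cvg; apply: cvg_near_cst.
apply: filterS (totally_fsuper [fset i]%fset) => J; rewrite fsub1set => iJ.
rewrite (big_fsetD1 i) //= big1_fset ?addr0 // => j.
by rewrite !inE => /andP[/x0].
Qed.

Section RealSums.
Context {R : realType}.
Variables (a : I -> R) (a0 : forall i, 0 <= a i).

Lemma fset_le_esum J :
  ((\sum_(i <- J) a i)%:E <= \esum_(i in [set: I]) (a i)%:E)%E.
Proof.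
apply: esum_ge; exists [set` J]; first by split=> //; exact: finite_fset.
by rewrite fsbig_finite ?set_fsetK ?sumEFin //; exact: finite_fset.
Qed.

Lemma esum_le_fset (M : R) : (forall J, \sum_(i <- J) a i <= M) ->
  (\esum_(i in [set: I]) (a i)%:E <= M%:E)%E.
Proof.
move=> aM; apply: ge_ereal_sup => _ [A [finA _] <-].
by rewrite fsbig_finite // sumEFin lee_fin.
Qed.

Lemma esum_fineK : (\esum_(i in [set: I]) (a i)%:E < +oo)%E ->
  (fine (\esum_(i in [set: I]) (a i)%:E))%:E = \esum_(i in [set: I]) (a i)%:E.
Proof.
move=> aoo; rewrite fineK // ge0_fin_numE //.
by apply: esum_ge0 => i _; rewrite lee_fin.
Qed.

(** The Cauchy criterion for a convergent nonnegative unordered sum. *)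
Lemma esum_tail (e : R) : (\esum_(i in [set: I]) (a i)%:E < +oo)%E -> 0 < e ->
  exists J0, forall J, (J0 `<=` J)%fset ->
    \sum_(i <- (J `\` J0)%fset) a i < e.
Proof.
move=> /esum_fineK; set s := fine _ => sE e0.
have [J0 sJ0] : exists J0, s - e < \sum_(i <- J0) a i.
  apply: contrapT => no.
  have : (\esum_(i in [set: I]) (a i)%:E <= (s - e)%:E)%E.
    apply: esum_le_fset => J; rewrite leNgt; apply/negP => h.
    by apply: no; exists J.
  by rewrite -sE lee_fin; lra.
exists J0 => J J0J; have := fset_le_esum J.
by rewrite -sE lee_fin (big_fset_sub _ J0J); lra.
Qed.

End RealSums.
End UnorderedSums.

(** * Synthesis and analysis operators *)

Section Fusion.
Context {R : realType} {k : scalar_kind} {H : hilbertSpace R k} {I : countType}.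
Local Notation K := (scalars R k).
Implicit Types (W : set H) (Wf Vf : I -> set H) (w v : I -> R) (f g h : I -> H).
Implicit Types (x y : H) (J : {fset I}).

Definition partial_synthesis w f J : H := \sum_(i <- J) sinj k (w i) *: f i.

Lemma l2sq_fineK f : (l2sq f < +oo)%E -> (fine (l2sq f))%:E = l2sq f.
Proof. by apply: esum_fineK => i; exact: sqr_ge0. Qed.

Lemma fset_le_l2sq f J : (l2sq f < +oo)%E ->
  \sum_(i <- J) hnorm (f i) ^+ 2 <= fine (l2sq f).
Proof.
move=> foo; rewrite -lee_fin l2sq_fineK //.
by apply: fset_le_esum => i; exact: sqr_ge0.
Qed.

Lemma l2sq_ge0 f : (0 <= l2sq f)%E.
Proof. by apply: esum_ge0 => i _; rewrite lee_fin sqr_ge0. Qed.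

Lemma l2norm_sqr f : l2norm f ^+ 2 = fine (l2sq f).
Proof. by rewrite sqr_sqrtr // fine_ge0 // l2sq_ge0. Qed.

Lemma frame_sum_ge0 Wf w x : (0 <= frame_sum Wf w x)%E.
Proof. by apply: esum_ge0 => i _; rewrite lee_fin mulr_ge0 // sqr_ge0. Qed.

Lemma fset_le_frame_sum Wf w x (M : R) J : (frame_sum Wf w x <= M%:E)%E ->
  \sum_(i <- J) w i ^+ 2 * hnorm (orth_proj (Wf i) x) ^+ 2 <= M.
Proof.
move=> /(le_trans _) h; rewrite -lee_fin; apply: h.
by apply: fset_le_esum => i; rewrite mulr_ge0 ?sqr_ge0.
Qed.

(** Each term [w_i <f_i, x>] equals [w_i <f_i, pi_i x>], so the pairing of a
synthesized vector with [x] only sees the projections measured by the frame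
sum. The weighted inequality of arithmetic and geometric means replaces the
Cauchy-Schwarz inequality for sums, which keeps everything linear in the two
square sums. *)
Lemma rdot_partial_synthesis_le Wf w f x J (c : R) : 0 < c ->
  (forall i, closed_subspace (Wf i)) -> (forall i, 0 < w i) ->
  (forall i, Wf i (f i)) ->
  2 * rdot (partial_synthesis w f J) x <=
    c * (\sum_(i <- J) hnorm (f i) ^+ 2) +
    c^-1 * (\sum_(i <- J) w i ^+ 2 * hnorm (orth_proj (Wf i) x) ^+ 2).
Proof.
move=> c0 cW w0 fW.
rewrite /partial_synthesis (big_morph (fun y => rdot y x)
  (fun y z => rdotDl y z x) (rdot0l x)) !mulr_sumr -big_split /=.
apply: ler_sum => i _; rewrite rdotZl -(rdot_orth_proj (cW i)) //.
have := rdot_le (f i) (orth_proj (Wf i) x).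
set a := hnorm (f i); set b := hnorm _; set r := rdot _ _ => rab.
have w0i := w0 i.
have h1 : w i * r <= w i * (a * b) by rewrite ler_wpM2l // ltW.
have h2 : 0 <= c^-1 * (c * a - w i * b) ^+ 2.
  by rewrite mulr_ge0 ?sqr_ge0 // invr_ge0 ltW.
have h3 : c^-1 * (c * a - w i * b) ^+ 2 =
    c * a ^+ 2 + c^-1 * (w i ^+ 2 * b ^+ 2) - 2 * (w i * (a * b)).
  by field; rewrite gt_eqF.
lra.
Qed.

Lemma partial_synthesis_sub w f J0 J : (J0 `<=` J)%fset ->
  partial_synthesis w f J - partial_synthesis w f J0 =
  partial_synthesis w f (J `\` J0)%fset.
Proof.
by move=> JJ; rewrite /partial_synthesis (big_fset_sub _ JJ) addrC addKr.
Qed.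

Section Bessel.
Variables (W : set H) (Wf : I -> set H) (w : I -> R) (beta : R).
Hypotheses (cW : closed_subspace W) (sW : subspace_family W Wf).
Hypotheses (ww : weights w) (beta0 : 0 < beta).
Hypothesis bW : forall x, W x ->
  (frame_sum Wf w x <= (beta * hnorm x ^+ 2)%:E)%E.

Let cWf i : closed_subspace (Wf i). Proof. by have [] := sW i. Qed.
Let w0 i : 0 < w i. Proof. by have [] := ww. Qed.

Lemma partial_synthesis_in f J : (forall i, Wf i (f i)) ->
  W (partial_synthesis w f J).
Proof.
move=> fW; have sU := closed_subspaceW cW.
by apply: subspace_sum => // i; apply: subspaceZ => //; apply: (sW i).2.
Qed.

(** The inequality [rdot_partial_synthesis_le] is used with [x] the
synthesized vector itself and [c = beta]: the Bessel bound makes the second term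
at most the square norm of [x], half of the left-hand side. *)
Lemma partial_synthesis_bound f J : (forall i, Wf i (f i)) ->
  hnorm (partial_synthesis w f J) ^+ 2
    <= beta * \sum_(i <- J) hnorm (f i) ^+ 2.
Proof.
move=> fW; set s := partial_synthesis w f J.
have := @rdot_partial_synthesis_le Wf w f s J beta beta0 cWf w0 fW.
rewrite -/s rdotxx.
have := fset_le_frame_sum J (bW (partial_synthesis_in J fW)); rewrite -/s.
set A := \sum_(i <- J) _; set B := \sum_(i <- J) _ => AB.
have : beta^-1 * A <= hnorm s ^+ 2 by rewrite mulrC ler_pdivrMr // mulrC.
by lra.
Qed.

(** The Bessel bound dominates the tails of the synthesis sum by those of the
square norm of the family, so the partial sums are Cauchy. *)
Lemma synthesis_cvg f : hilbert_sum Wf f ->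
  partial_synthesis w f @ summability.totally --> synthesis w f.
Proof.
move=> [fW foo].
have [l fl] : exists l : H, partial_synthesis w f @ summability.totally --> l.
  apply: hnorm_cauchy_cvg => e e0.
  have e2 : 0 < e ^+ 2 / beta by rewrite divr_gt0 // exprn_gt0.
  have [J0 J0P] := esum_tail (fun i => sqr_ge0 (hnorm (f i))) foo e2.
  exists (partial_synthesis w f J0).
  apply: filterS (totally_fsuper J0) => J JJ.
  rewrite hdistC partial_synthesis_sub //.
  rewrite -(@ltr_pXn2r _ 2) ?nnegrE ?hnorm_ge0 ?ltW //.
  apply: le_lt_trans (partial_synthesis_bound _ fW) _.
  by have := J0P J JJ; rewrite ltr_pdivlMr // mulrC.
by rewrite /synthesis (sum_cvg fl).
Qed.

Lemma rdot_synthesis_le f x (c M : R) : 0 < c -> hilbert_sum Wf f ->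
  (frame_sum Wf w x <= M%:E)%E ->
  2 * rdot (synthesis w f) x <= c * l2norm f ^+ 2 + c^-1 * M.
Proof.
move=> c0 fW xM; rewrite -ler_pdivlMl //.
apply: cvg_rdot_le (synthesis_cvg fW) _ => J; rewrite ler_pdivlMl //.
have [fWi foo] := fW.
apply: le_trans (rdot_partial_synthesis_le _ _ c0 cWf w0 fWi) _.
rewrite lerD // ler_pM2l ?invr_gt0 //.
  by rewrite l2norm_sqr fset_le_l2sq.
exact: fset_le_frame_sum.
Qed.

Lemma frame_sum_proj x : frame_sum Wf w (orth_proj W x) = frame_sum Wf w x.
Proof.
apply: eq_esum => i _; congr (_%:E); congr (_ * (hnorm _) ^+ 2).
by apply: orth_proj_sub => //; exact: (sW i).2.
Qed.

(** The Bessel bound, assumed on [W] only, extends to the whole space because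
the frame sum of [x] is that of its projection to [W]. *)
Lemma frame_sum_le x : (frame_sum Wf w x <= (beta * hnorm x ^+ 2)%:E)%E.
Proof.
rewrite -frame_sum_proj; apply: le_trans (bW (orth_projP cW x).1) _.
rewrite lee_fin ler_pM2l // ler_pXn2r ?nnegrE ?hnorm_ge0 //.
exact: hnorm_orth_proj.
Qed.

Lemma l2sq_proj x :
  l2sq (fun i => sinj k (w i) *: orth_proj (Wf i) x) = frame_sum Wf w x.
Proof.
apply: eq_esum => i _; congr (_%:E).
by rewrite hnormZr ?exprMn // ltW.
Qed.

Lemma hilbert_sum_proj x :
  hilbert_sum Wf (fun i => sinj k (w i) *: orth_proj (Wf i) x).
Proof.
split=> [i|]; last by rewrite l2sq_proj (le_lt_trans (frame_sum_le x)) ?ltry.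
by apply: subspaceZ; [exact: closed_subspaceW|exact: (orth_projP (cWf i) x).1].
Qed.

Lemma hilbert_sum_component i y : Wf i y ->
  hilbert_sum Wf (component i (fun=> y)).
Proof.
move=> yW; split=> [j|]; rewrite /component.
  by case: eqVneq => [->//|_]; exact: (closed_subspaceW (cWf j)).1.
apply: (@le_lt_trans _ _ ((hnorm y ^+ 2)%:E)); last exact: ltry.
apply: esum_le_fset => J.
have [iJ|iJ] := boolP (i \in J).
  rewrite (big_fsetD1 i) //= eqxx big1_fset ?addr0 // => j.
  by rewrite !inE => /andP[/negPf-> _]; rewrite hnorm0 expr0n.
rewrite big1_fset ?sqr_ge0 // => j jJ _.
by case: eqP => [ji|_]; [rewrite -ji jJ in iJ|rewrite hnorm0 expr0n].
Qed.

Lemma l2dot_component i y h :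
  l2dot (component i (fun=> y)) h = dot H y (h i).
Proof.
rewrite /l2dot (@sum_single _ _ _ _ i) /component ?eqxx // => j /negPf ->.
exact: dot0l.
Qed.

Lemma l2dot_proj g x : hilbert_sum Wf g ->
  dot H (synthesis w g) x =
  l2dot g (fun i => sinj k (w i) *: orth_proj (Wf i) x).
Proof.
move=> gW; apply/esym/sum_cvg.
rewrite (_ : (fun J => _) = fun J => dot H (partial_synthesis w g J) x : K^o).
  exact: cvg_dot (synthesis_cvg gW).
apply/funext => J; rewrite /partial_synthesis (big_morph (fun y => dot H y x)
  (fun y z => dotDl y z x) (dot0l x)).
apply: eq_bigr => i _; rewrite dotZl dotZr sconj_inj dot_orth_proj //.
by case: gW.
Qed.

(** The right-hand side satisfies the adjoint relation; it is the only such
family, because the adjoint relation tested against families with one nonzero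
component determines each component. *)
Lemma analysisE x :
  analysis Wf w x = fun i => sinj k (w i) *: orth_proj (Wf i) x.
Proof.
rewrite /analysis /adjoint; set h0 := (X in _ = X).
case: xgetP => [h _ [[hW _] hP]|/= no]; last first.
  case: (no h0); split; first exact: hilbert_sum_proj.
  by move=> g; exact: l2dot_proj.
apply/funext => i; apply/eqP; rewrite -subr_eq0; apply/eqP/hnorm_eq0.
have [h0W _] := hilbert_sum_proj x.
have hi : Wf i (h i - h0 i).
  by apply: (subspaceB (closed_subspaceW (cWf i))); [exact: hW|exact: h0W].
have gW := hilbert_sum_component hi.
have := hP _ gW; rewrite (l2dot_proj _ gW) !l2dot_component => e.
apply/eqP; rewrite -sqrf_eq0 -rdotxx rdotDr rdotNr /rdot.
by rewrite -e subrr.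
Qed.

Lemma analysis_in x : hilbert_sum Wf (analysis Wf w x).
Proof. by rewrite analysisE; exact: hilbert_sum_proj. Qed.

Lemma analysis_linear a x y : analysis Wf w (a *: x + y) =
  a *: analysis Wf w x + analysis Wf w y.
Proof.
rewrite !analysisE; apply/funext => i.
by rewrite !fctE orth_proj_linear // scalerDr !scalerA mulrC.
Qed.

Lemma analysis_orth x : orth W x -> analysis Wf w x = 0.
Proof.
move=> xW; rewrite analysisE; apply/funext => i.
by rewrite orth_proj0 ?scaler0 //; apply: orthS xW; exact: (sW i).2.
Qed.

Lemma l2norm_analysis_le x :
  l2norm (analysis Wf w x) ^+ 2 <= beta * hnorm x ^+ 2.
Proof.
rewrite l2norm_sqr -lee_fin l2sq_fineK; last by case: (analysis_in x).
by rewrite analysisE l2sq_proj; exact: frame_sum_le.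
Qed.

Lemma synthesis_linear a f g : hilbert_sum Wf f -> hilbert_sum Wf g ->
  synthesis w (a *: f + g) = a *: synthesis w f + synthesis w g.
Proof.
move=> fW gW; apply: sum_cvg.
rewrite (_ : (fun J => _) =
  (fun J => a *: partial_synthesis w f J + partial_synthesis w g J)).
  by apply: cvgD; [apply: cvgZr|]; exact: synthesis_cvg.
apply/funext => J; rewrite /partial_synthesis scaler_sumr -big_split /=.
by apply: eq_bigr => i _; rewrite !fctE scalerDr !scalerA mulrC.
Qed.

End Bessel.
End Fusion.

(** * Operator norm and Neumann series *)

Section BoundedMaps.
Context {R : realType} {k : scalar_kind} {H : hilbertSpace R k}.
Local Notation K := (scalars R k).
Implicit Types (T : H -> H) (x y : H).

Definition linear_map T := forall (a : K) x y, T (a *: x + y) = a *: T x + T y.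

Lemma linear_map0 T : linear_map T -> T 0 = 0.
Proof.
by move=> lT; have := lT (- 1) 0 0; rewrite !scaleN1r !addNr.
Qed.

Lemma linear_mapD T x y : linear_map T -> T (x + y) = T x + T y.
Proof. by move=> lT; have := lT 1 x y; rewrite !scale1r. Qed.

Lemma linear_mapZ T (a : K) x : linear_map T -> T (a *: x) = a *: T x.
Proof. by move=> lT; have := lT a x 0; rewrite (linear_map0 lT) !addr0. Qed.

Lemma linear_mapB T x y : linear_map T -> T (x - y) = T x - T y.
Proof.
by move=> lT; rewrite linear_mapD // -scaleN1r linear_mapZ // scaleN1r.
Qed.

Lemma linear_map_sum T (J : Type) (s : seq J) (F : J -> H) : linear_map T ->
  T (\sum_(i <- s) F i) = \sum_(i <- s) T (F i).
Proof.
move=> lT; apply: big_morph => [x y|]; first exact: linear_mapD.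
exact: linear_map0.
Qed.

Lemma linear_map_iter T n : linear_map T -> linear_map (iter n T).
Proof. by move=> lT; elim: n => [|n IHn] a x y //=; rewrite IHn lT. Qed.

Lemma hnorm_le_opnorm T (M : R) x : linear_map T ->
  (opnorm T <= M%:E)%E -> hnorm (T x) <= M * hnorm x.
Proof.
move=> lT TM; have [->|x0] := eqVneq x 0.
  by rewrite (linear_map0 lT) hnorm0 mulr0.
have nx0 : 0 < hnorm x.
  rewrite lt_neqAle hnorm_ge0 andbT eq_sym.
  by apply: contra_neq x0; exact: hnorm_eq0.
have ny : hnorm (sinj k (hnorm x)^-1 *: x) = 1.
  by rewrite hnormZr ?invr_ge0 ?hnorm_ge0 // mulVf // gt_eqF.
have : ((hnorm (T (sinj k (hnorm x)^-1 *: x)))%:E <= M%:E)%E.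
  apply: le_trans TM; apply: ereal_sup_ubound.
  by exists (sinj k (hnorm x)^-1 *: x) => //=; rewrite ny.
rewrite lee_fin linear_mapZ // hnormZr ?invr_ge0 ?hnorm_ge0 //.
by rewrite ler_pdivrMl // mulrC.
Qed.

Lemma opnorm_le T (M : R) : 0 <= M ->
  (forall x, hnorm (T x) <= M * hnorm x) -> (opnorm T <= M%:E)%E.
Proof.
move=> M0 TM; apply: ge_ereal_sup => _ [x /= x1 <-]; rewrite lee_fin.
by apply: le_trans (TM x) _; rewrite ler_piMr.
Qed.

Lemma opnormB (S T : H -> H) :
  opnorm (fun x => S x - T x) = opnorm (fun x => T x - S x).
Proof.
by congr ereal_sup; apply/seteqP; split=> _ [x x1 <-]; exists x => //;
  rewrite hdistC.
Qed.

Lemma bounded_cvg T (C : R) {J} {F : set_system J} {FF : ProperFilter F}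
    (f : J -> H) l : linear_map T ->
  (forall x, hnorm (T x) <= C * hnorm x) ->
  f @ F --> l -> (fun j => T (f j)) @ F --> T l.
Proof.
move=> lT TC /cvg_hnormP fl; apply/cvg_hnormP => e e0.
have C1 : 0 < `|C| + 1 by rewrite ltr_wpDl.
have := fl (e / (`|C| + 1)); rewrite divr_gt0 // => /(_ isT).
apply: filterS => j; rewrite ltr_pdivlMr // -linear_mapB // => lt.
apply: le_lt_trans (TC _) _; have := hnorm_ge0 (l - f j).
by have := ler_norm C; nra.
Qed.

Section GeometricSum.
Variables (E : H -> H) (q : R).
Hypotheses (lE : linear_map E) (q0 : 0 <= q).
Hypothesis Eq : forall x, hnorm (E x) <= q * hnorm x.

Lemma iter_bound n x : hnorm (iter n E x) <= q ^+ n * hnorm x.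
Proof.
elim: n => [|n IHn]; first by rewrite expr0 mul1r.
by rewrite exprS -mulrA iterS (le_trans (Eq _)) // ler_wpM2l.
Qed.

Lemma geometric_sum_linear N : linear_map (geometric_sum E N).
Proof.
move=> a x y; rewrite /geometric_sum scaler_sumr -big_split /=.
by apply: eq_bigr => n _; exact: linear_map_iter.
Qed.

Lemma geometric_sum_bound N x :
  hnorm (geometric_sum E N x) <= (\sum_(0 <= n < N.+1) q ^+ n) * hnorm x.
Proof.
rewrite /geometric_sum mulr_suml.
elim/big_ind2: _ => [|y r z s yr zs|n _]; first by rewrite hnorm0.
  by apply: le_trans (hnorm_triangle _ _) _; exact: lerD.
exact: iter_bound.
Qed.

(** The Neumann series applied to [D = P - E] telescopes: for positive [n] the
operators [E^n P] and [E^n] agree, so only the term of index [0] sees [P]. *)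
Lemma geometric_sum_defect (P D : H -> H) N x :
  (forall y, E y = P y - D y) -> (forall y, E (P y) = E y) ->
  P x - geometric_sum E N (D x) = iter N.+1 E x.
Proof.
move=> EPD EP; elim: N => [|N IHN].
  by rewrite /geometric_sum big_nat1 /= EPD.
rewrite /geometric_sum big_nat_recr // opprD addrA IHN [in RHS]iterSr EPD.
by rewrite (linear_mapB _ _ (linear_map_iter _ lE)) !iterSr EP.
Qed.

End GeometricSum.
End BoundedMaps.

(** * Approximate duals *)

Section Duals.
Context {R : realType} {k : scalar_kind} {H : hilbertSpace R k} {I : countType}.
Local Notation K := (scalars R k).
Implicit Types (V W : set H) (Wf Vf : I -> set H) (w v : I -> R).
Implicit Types (f g h : I -> H) (x y : H).

Lemma fusion_frame_bessel W Wf w : fusion_frame W Wf w -> fusion_bessel W Wf w.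
Proof.
move=> [sW ww [alpha [beta [a0 ab abW]]]]; split=> //.
by exists beta; [exact: lt_le_trans a0 ab|move=> x /abW[]].
Qed.

Lemma bounded_operator_comp (D1 D2 D3 : set (I -> H)) Q1 Q2 :
  bounded_operator D1 D2 Q1 -> bounded_operator D2 D3 Q2 ->
  bounded_operator D1 D3 (Q2 \o Q1).
Proof.
move=> [Q1D Q1l [C1 Q1C]] [Q2D Q2l [C2 Q2C]].
split=> [f /Q1D/Q2D //|a f g Df Dg|].
  by rewrite /= Q1l // Q2l //; exact: Q1D.
exists (`|C2| * `|C1|) => f Df /=.
have h1 := Q1C f Df; have h2 := Q2C _ (Q1D _ Df).
have h3 := ler_norm C1; have h4 := ler_norm C2.
apply: le_trans h2 _; rewrite -mulrA.
apply: (@le_trans _ _ (`|C2| * l2norm (Q1 f))).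
  by rewrite ler_wpM2r // sqrtr_ge0.
rewrite ler_wpM2l //; apply: le_trans h1 _.
by rewrite ler_wpM2r // sqrtr_ge0.
Qed.

Lemma synthesis_component v f i :
  synthesis v (component i f) = sinj k (v i) *: f i :> H.
Proof.
rewrite /synthesis (@sum_single _ _ _ _ i) /component ?eqxx // => j /negPf ->.
by rewrite scaler0.
Qed.

(** The weights cancel termwise, leaving the image under [A] of the partial sums
of the first synthesis operator; continuity of [A] then commutes it with the
unordered sum. *)
Lemma synthesis_Qmap (A : H -> H) (C : R) v vt f : linear_map A ->
  (forall x, hnorm (A x) <= C * hnorm x) -> (forall i, 0 < vt i) ->
  partial_synthesis v f @ summability.totally --> (synthesis v f : H) ->
  synthesis vt (Qmap (A \o synthesis v) vt f) = A (synthesis v f).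
Proof.
move=> lA AC vt0 fc; apply: sum_cvg.
rewrite (_ : (fun J => _) = fun J => A (partial_synthesis v f J)).
  exact: bounded_cvg lA AC fc.
apply/funext => J; rewrite /partial_synthesis linear_map_sum //.
apply: eq_bigr => i _; rewrite /Qmap scalerA -sinjM mulfV ?gt_eqF //.
by rewrite sinj1 scale1r /= synthesis_component.
Qed.

Section DualOperator.
Variables (V W : set H) (Wf Vf : I -> set H) (w v : I -> R).
Variable Q : (I -> H) -> I -> H.
Hypotheses (cV : closed_subspace V) (cW : closed_subspace W).
Hypotheses (bW : fusion_bessel W Wf w) (bV : fusion_bessel V Vf v).
Hypothesis bQ : bounded_operator (hilbert_sum Wf) (hilbert_sum Vf) Q.

Lemma dual_operator_linear : linear_map (dual_operator Wf w v Q).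
Proof.
case: bW bV bQ => [sW ww [b b0 Wb]] [sV vv [c c0 Vc]] [QD Ql _] a x y.
rewrite /dual_operator (analysis_linear cW sW ww b0 Wb) Ql; last 2 first.
- exact: (analysis_in cW sW ww b0 Wb).
- exact: (analysis_in cW sW ww b0 Wb).
by apply: (synthesis_linear cV sV vv c0 Vc); apply: QD;
   exact: (analysis_in cW sW ww b0 Wb).
Qed.

Lemma dual_operator_orth x : orth W x -> dual_operator Wf w v Q x = 0.
Proof.
case: bW => [sW ww [b b0 Wb]] xW.
rewrite -(linear_map0 dual_operator_linear) /dual_operator.
congr (synthesis v (Q _)).
have sO := subspace_orth W.
by rewrite !(analysis_orth cW sW ww b0 Wb) //; exact: sO.1.
Qed.

(** With [D = T_V Q T_W^*], the real part of [<D x, x>] is at least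
[(1 - e) |x|^2], and it is controlled by the norm of [Q T_W^* x], hence by that
of [x], and by the frame sum of [x]. The weight [d / M] in the inequality of
arithmetic and geometric means is the one for which the first term is at most
half of the lower bound, leaving the other half to the frame sum. *)
Lemma approximate_dual_fusion_frame (e : R) : e < 1 ->
  (forall x, V x -> hnorm (x - dual_operator Wf w v Q x) <= e * hnorm x) ->
  fusion_frame V Vf v.
Proof.
case: bW bV bQ => [sW ww [b b0 Wb]] [sV vv [c c0 Vc]] [QD _ [C QC]] e1 Ve.
split=> //.
(* [C ^+ 2 * b] bounds the square norm of [Q T_W^*]; adding 1 makes [M]
invertible. *)
pose d := 1 - e; pose M := C ^+ 2 * b + 1.
have d0 : 0 < d by rewrite /d; lra.
have M0 : 0 < M by rewrite ltr_wpDl // mulr_ge0 ?sqr_ge0 // ltW.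
exists (Num.min (d ^+ 2 / M) c), c; split.
- by rewrite lt_min c0 divr_gt0 ?exprn_gt0.
- by rewrite ge_min lexx orbT.
move=> x Vx; split; last exact: Vc.
have xoo : (frame_sum Vf v x < +oo)%E.
  by rewrite (le_lt_trans (Vc x Vx)) // ltry.
have : frame_sum Vf v x \is a fin_num by rewrite ge0_fin_numE // frame_sum_ge0.
move=> /fineK; set F := fine _ => FE.
have hx := analysis_in cW sW ww b0 Wb x.
have dM0 : 0 < d / M by rewrite divr_gt0.
have FF : (frame_sum Vf v x <= F%:E)%E by rewrite FE.
have := rdot_synthesis_le cV sV vv c0 Vc dM0 (QD _ hx) FF.
rewrite -[synthesis v _]/(dual_operator Wf w v Q x).
set y := dual_operator _ _ _ _ _ => h1.
have h2 := le_trans (rdot_le (x - y) x) (ler_wpM2r (hnorm_ge0 x) (Ve x Vx)).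
rewrite rdotDl rdotNl rdotxx in h2.
have h3 : l2norm (Q (analysis Wf w x)) ^+ 2 <= M * hnorm x ^+ 2.
  have q0 : 0 <= l2norm (Q (analysis Wf w x)) by rewrite sqrtr_ge0.
  have a0 : 0 <= l2norm (analysis Wf w x) by rewrite sqrtr_ge0.
  have := QC _ hx; have := l2norm_analysis_le cW sW ww b0 Wb x.
  set a := l2norm _ in a0 *; set q := l2norm _ in q0 * => ab qC.
  have : q ^+ 2 <= C ^+ 2 * a ^+ 2.
    rewrite -exprMn ler_pXn2r ?nnegrE //; exact: le_trans qC.
  have := ler_wpM2l (sqr_ge0 C) ab; rewrite /M.
  have := sqr_ge0 (hnorm x); nra.
rewrite -FE lee_fin; set n2 := hnorm x ^+ 2.
have n20 : 0 <= n2 by exact: sqr_ge0.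
have h4 : d / M * l2norm (Q (analysis Wf w x)) ^+ 2 <= d * n2.
  apply: le_trans (ler_wpM2l (ltW dM0) h3) _.
  by rewrite mulrA divfK ?gt_eqF.
have h5 : d * n2 <= M / d * F.
  have : n2 - rdot y x <= e * n2 by rewrite /n2 [in leRHS]expr2 mulrA.
  by rewrite invf_div in h1; rewrite /d in h1 h4 *; lra.
apply: (@le_trans _ _ (d ^+ 2 / M * n2)).
  by rewrite ler_wpM2r // ge_min lexx.
rewrite mulrAC ler_pdivrMr // expr2 -mulrA.
apply: le_trans (ler_wpM2l (ltW d0) h5) _.
by rewrite mulrA mulrCA divff ?gt_eqF // mulr1 mulrC.
Qed.

End DualOperator.
End Duals.

Theorem theorem5p1 (R : realType) (k : scalar_kind) (H : hilbertSpace R k)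
  (I : countType) (V W : set H) (Wf Vf : I -> set H) (w v : I -> R)
  (Q : (I -> H) -> I -> H) (eps : R)
  (hH : separable H)
  (hV : closed_subspace V) (hW : closed_subspace W)
  (hVW : direct_sum V (orth W))
  (hWf : fusion_frame W Wf w)
  (hQ : bounded_operator (hilbert_sum Wf) (hilbert_sum Vf) Q)
  (heps : 0 <= eps < 1)
  (hdual : approx_oblique_dual V W eps Q Wf w Vf v) :
  let P := oblique_proj V (orth W) in
  let A := geometric_sum (fun x => P x - dual_operator Wf w v Q x) in
  (forall (N : nat) (vt : I -> R),
     let AVf := image_family (A N) Vf in
     let QA := Qmap (A N \o synthesis v) vt in
     weights vt ->
     fusion_bessel V AVf vt ->
     bounded_operator (hilbert_sum Vf) (hilbert_sum AVf) QA ->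
     approx_oblique_dual V W (eps ^+ N.+1) (QA \o Q) Wf w AVf vt /\
     (opnorm (fun x => (P x - dual_operator Wf w vt (QA \o Q) x)%R)
        <= (eps ^+ N.+1)%:E)%E) /\
  eps ^+ N.+1 @[N --> \oo] --> 0.
Proof.
move=> P A; move: heps => /andP[eps0 eps1]; split; last first.
  rewrite (cvg_shiftS (fun n => eps ^+ n)).
  by apply: cvg_expr; rewrite ger0_norm.
move=> N vt AVf QA vtw AVb QAb.
have bW := fusion_frame_bessel hWf.
have [_ _ fV _ hD] := hdual; have bV := fusion_frame_bessel fV.
have sV := closed_subspaceW hV; have sO := subspace_orth W.
pose D := dual_operator Wf w v Q; pose E x := P x - D x.
have lD : linear_map D by exact: dual_operator_linear hV hW bW bV hQ.
have lP : linear_map P by exact: oblique_proj_linear.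
have lE : linear_map E.
  by move=> a x y; rewrite /E lP lD scalerBr opprD addrACA.
have Eeps x : hnorm (E x) <= eps * hnorm x.
  by apply: hnorm_le_opnorm => //; rewrite opnormB.
have PP x : P (P x) = P x.
  by apply: (oblique_proj_id sV sO hVW); have [] := oblique_projP hVW x.
have DP x : D (P x) = D x.
  apply/esym/eqP; rewrite -subr_eq0 -linear_mapB //; apply/eqP.
  apply: (dual_operator_orth hV hW bW bV hQ).
  by have [] := oblique_projP hVW x.
have EP x : E (P x) = E x by rewrite /E PP DP.
have lA : linear_map (A N) := geometric_sum_linear lE N.
have Ab := geometric_sum_bound eps0 Eeps N.
have QQ := bounded_operator_comp hQ QAb.
have DA x : dual_operator Wf w vt (QA \o Q) x = A N (D x).
  case: bV hQ bW => [sVf vv [c c0 Vc]] [QD _ _] [sW ww [b b0 Wb]].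
  apply: (synthesis_Qmap lA Ab); first by case: vtw.
  apply: (synthesis_cvg hV sVf vv c0 Vc); apply: QD.
  exact: (analysis_in hW sW ww b0 Wb).
have defect x : P x - dual_operator Wf w vt (QA \o Q) x = iter N.+1 E x.
  by rewrite DA; apply: geometric_sum_defect.
have epsN0 : 0 <= eps ^+ N.+1 by exact: exprn_ge0.
have bound x : hnorm (P x - dual_operator Wf w vt (QA \o Q) x)
    <= eps ^+ N.+1 * hnorm x.
  by rewrite defect; exact: iter_bound.
have opb := opnorm_le epsN0 bound.
split=> //; split=> //; last by rewrite opnormB.
apply: (approximate_dual_fusion_frame hV hW bW AVb QQ (e := eps ^+ N.+1)).
  by rewrite exprn_ilt1.
by move=> x Vx; have := bound x; rewrite {1}/P (oblique_proj_id sV sO hVW).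
Qed.
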